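(* Let $H$ be a finite set of unit vectors in $\mathbb{R}^d$ not contained in any closed half of the unit sphere, let $k=|H|$, let $n$ be a positive integer and let $S\subset\mathbb{R}^d$ be a discrete point set. Let $\mathcal{F}_1,\dots,\mathcal{F}_k$ be finite families of $H$-convex sets such that for every choice $F_1\in\mathcal{F}_1,\dots,F_k\in\mathcal{F}_k$, the intersection $F_1\cap\cdots\cap F_k$ contains at least $n$ points of $S$. Then there exists $i\in[k]$ such that $\bigcap\mathcal{F}_i$ contains at least $n$ points of $S$.
   Context: For a set $H\subseteq S^{d-1}$ of unit vectors not contained in any closed half-sphere, a set in $\mathbb{R}^d$ is $H$-convex if it can be written as an intersection of halfspaces of the form $\{x\in\mathbb{R}^d:\langle x,h\rangle\le c\}$ with $h\in H$ and $c\in\mathbb{R}$. *)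

(* Defs.v *)
From HB Require Import structures.
From mathcomp Require Import all_boot all_order all_algebra.
From mathcomp Require Import all_classical all_reals all_analysis.
Import Order.TTheory GRing.Theory Num.Theory.
Import numFieldNormedType.Exports.

Set Implicit Arguments.
Unset Strict Implicit.
Unset Printing Implicit Defensive.

Local Open Scope classical_set_scope.
Local Open Scope ring_scope.

Definition dotv (R : realType) (d : nat) (x y : 'rV[R]_d) : R :=
  \sum_(i < d) x ord0 i * y ord0 i.

(* The library norm `|x| on 'rV[R]_d is the sup norm, so the Euclidean norm is
   needed separately. *)
Definition enorm (R : realType) (d : nat) (x : 'rV[R]_d) : R :=
  Num.sqrt (dotv x x).

Definition unit_sphere (R : realType) (d : nat) : set 'rV[R]_d :=
  [set x | enorm x = 1].

Definition closed_half_sphere (R : realType) (d : nat) (u : 'rV[R]_d) :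
    set 'rV[R]_d :=
  @unit_sphere R d `&` [set x | 0 <= dotv x u].

Definition halfspace (R : realType) (d : nat) (h : 'rV[R]_d) (c : R) :
    set 'rV[R]_d :=
  [set x | dotv x h <= c].

(* The family C may be infinite, or empty (its intersection is then the whole
   space). *)
Definition Hconvex (R : realType) (d : nat) (H A : set 'rV[R]_d) : Prop :=
  exists C : set (set 'rV[R]_d),
    (forall B, C B -> exists h c, H h /\ B = halfspace h c) /\
    A = \bigcap_(B in C) B.

(* Every point of S is isolated in S. S is not required to be closed, hence
   locally finite sets are a special case. The topology of 'rV[R]_d is the
   Euclidean one. *)
Definition discrete_set (R : realType) (d : nat) (S : set 'rV[R]_d) : Prop :=
  S `<=` isolated S.

Definition at_least (T : Type) (n : nat) (A : set T) : Prop := (`I_n #<= A)%card.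

(* Main.v *)
(** Replace each set A by its hulls in the single directions h of H: the hull
    in direction h is the intersection of all halfspaces with normal h that
    contain A. The hulls in one direction form a chain under inclusion, and an
    H-convex set is the intersection of its hulls.

    Go through the k directions one by one. In direction h, choose among all
    members of the remaining families one whose hull is smallest, and discard
    the family (colour) it comes from. The family i0 treated last was present at
    every stage, so in each direction the chosen set has a hull contained in the
    hull of every member of F i0. Hence the intersection of the chosen sets, one
    of each colour, is contained in the intersection of F i0. *)
Require Import Defs.
From HB Require Import structures.
From mathcomp Require Import all_boot all_order all_algebra.
From mathcomp Require Import all_classical all_reals all_analysis.
Import Order.TTheory GRing.Theory Num.Theory.
Import numFieldNormedType.Exports.
Local Open Scope classical_set_scope.
Local Open Scope ring_scope.

Lemma finite_total_preorder_min (T : choiceType) (le : T -> T -> Prop)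
    (le_total : forall x y, le x y \/ le y x)
    (le_trans : forall x y z, le x y -> le y z -> le x z) (X : set T) :
  finite_set X -> X !=set0 -> exists2 x, X x & forall y, X y -> le x y.
Proof.
move=> /finite_seqP[s ->] [x0 /=]; elim: s x0 => // a s IHs _ _.
case: s IHs => [|b s] IHs.
  exists a; first by rewrite /= mem_head.
  by move=> y /=; rewrite inE => /eqP ->; case: (le_total a a).
have [x /= xs x_min] := IHs b (mem_head b s).
have [le_ax|le_xa] := le_total a x.
- exists a => [|y /=]; first by rewrite /= mem_head.
  rewrite inE => /predU1P[->|ys]; first by case: (le_total a a).
  exact: le_trans le_ax (x_min y ys).
- exists x => [|y /=]; first by rewrite /= inE xs orbT.
  by rewrite inE => /predU1P[->//|]; exact: x_min.
Qed.

(** Induction on the number [n] of directions, with [C] the colours still available; [e n] is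
    treated first. *)
Lemma colorful_transversal (I : finType) (J : Type) (T : choiceType)
    (le : J -> T -> T -> Prop)
    (le_total : forall j x y, le j x y \/ le j y x)
    (le_trans : forall j x y z, le j x y -> le j y z -> le j x z)
    (F : I -> set T) (F_finite : forall i, finite_set (F i))
    (F_nonempty : forall i, F i !=set0) (n : nat) (e : nat -> J)
    (C : {set I}) :
  (0 < #|C|)%N -> (n <= #|C|)%N ->
  exists G : I -> T, exists2 i0, i0 \in C & (forall i, F i (G i)) /\
    forall j, (j < n)%N ->
      exists2 i, i \in C & forall x, F i0 x -> le (e j) (G i) x.
Proof.
(* [G0] fills in the colours that are never selected. *)
have [G0 G0F] := choice F_nonempty.
elim: n C => [|n IHn] C C_gt0 leC.
  by have /card_gt0P[i iC] := C_gt0; exists G0, i.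
have [||x [i1 /= i1C Fx] x_min] := @finite_total_preorder_min T (le (e n))
    (le_total _) (le_trans _) (\bigcup_(i in [set` C]) F i).
- by apply: bigcup_finite => //; exact: finite_finset.
- have /card_gt0P[i iC] := C_gt0.
  by have [x Fx] := F_nonempty i; exists x, i.
have update_in G : (forall i, F i (G i)) ->
    forall i, F i (if i == i1 then x else G i).
  by move=> GF i; case: eqP => [->|_].
(* In the last direction [C] may be just [i1], with nothing left after discarding it, so [i1] itself
   serves as [i0]. Hence as many colours as directions suffice. *)
have [n0|n_gt0] := posnP n.
  exists (fun i => if i == i1 then x else G0 i), i1 => //; split; first exact: update_in.
  move=> j; rewrite n0 ltnS leqn0 => /eqP ->; exists i1 => // y Fy.
  by rewrite eqxx -n0; apply: x_min; exists i1.
have leC1 : (n <= #|C :\ i1|)%N by rewrite (cardsD1 i1) i1C in leC.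
have [G [i0 /setD1P[_ i0C] [GF G_min]]] := IHn _ (leq_trans n_gt0 leC1) leC1.
exists (fun i => if i == i1 then x else G i), i0 => //; split; first exact: update_in.
move=> j; rewrite ltnS leq_eqVlt => /predU1P[->|/G_min[i /setD1P[ii1 iC] leG]].
  (* The survivor [i0] lies in [C], so [x] was minimal against [F i0] too. *)
  by exists i1 => // y Fy; rewrite eqxx; apply: x_min; exists i0.
by exists i => // y Fy; rewrite (negbTE ii1); exact: leG.
Qed.

(** Avoiding the supremum of [dotv a h] over [A] spares case distinctions: the hull is empty for
    empty [A], and the whole space if [A] is unbounded in direction [h]. *)
Definition dir_hull {R : realType} {d : nat} (h : 'rV[R]_d) (A : set 'rV[R]_d) :
    set 'rV[R]_d :=
  [set x | forall c, A `<=` halfspace h c -> halfspace h c x].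

(** If [y] in the hull of [B] violates a bound [c] of [A], then [c] lies below every bound of
    [B]. *)
Lemma dir_hull_total (R : realType) (d : nat) (h : 'rV[R]_d)
    (A B : set 'rV[R]_d) :
  dir_hull h A `<=` dir_hull h B \/ dir_hull h B `<=` dir_hull h A.
Proof.
have [|nAB] := pselect (dir_hull h A `<=` dir_hull h B); [by left | right].
move=> y yB c Ac; apply: contrapT => yc; apply: nAB => x xA b Bb.
move/negP: yc; rewrite -ltNge => /ltW cy.
exact: le_trans (xA c Ac) (le_trans cy (yB b Bb)).
Qed.

Lemma bigcap_dir_hull (R : realType) (d : nat) (H A : set 'rV[R]_d) :
  Hconvex H A -> \bigcap_(h in H) dir_hull h A `<=` A.
Proof.
move=> [C [C_half AE]] x xA; rewrite AE => B CB.
have [h [c [Hh BE]]] := C_half B CB.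
by rewrite BE; apply: (xA h Hh) => y; rewrite AE -BE => /(_ B CB).
Qed.

Lemma unit_sphere_nonempty (R : realType) (d : nat) :
  (0 < d)%N -> @unit_sphere R d !=set0.
Proof.
case: d => // d _; exists (delta_mx ord0 ord0).
rewrite /unit_sphere /= /enorm /dotv big_ord_recl big1 => [|i _].
  by rewrite !mxE !eqxx /= mulr1 addr0 sqrtr1.
by rewrite !mxE /= mulr0.
Qed.

Theorem theorem5p3 (R : realType) (d : nat) (d_gt0 : (0 < d)%N)
    (k : nat) (H : set 'rV[R]_d) (H_card : (H #= `I_k)%card)
    (H_unit : H `<=` @unit_sphere R d)
    (H_half : forall u : 'rV[R]_d, @unit_sphere R d u ->
       ~ (H `<=` closed_half_sphere u))
    (n : nat) (n_gt0 : (0 < n)%N)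
    (S : set 'rV[R]_d) (S_discrete : discrete_set S)
    (F : 'I_k -> set (set 'rV[R]_d))
    (F_finite : forall i, finite_set (F i))
    (F_nonempty : forall i, F i !=set0)
    (F_convex : forall i A, F i A -> Hconvex H A)
    (F_choice : forall G : 'I_k -> set 'rV[R]_d, (forall i, F i (G i)) ->
       at_least n (S `&` \bigcap_i G i)) :
  exists i : 'I_k, at_least n (S `&` \bigcap_(A in F i) A).
Proof.
have k_gt0 : (0 < k)%N.
  rewrite lt0n; apply/eqP => k0; have [u u1] := unit_sphere_nonempty R d d_gt0.
  apply: (H_half u u1); move: H_card; rewrite k0 II0 card_eq0 => /eqP ->.
  exact: sub0set.
have [e [_ _ e_surj]] : exists e : nat -> 'rV[R]_d, set_bij `I_k H e.
  by apply/card_set_bijP; rewrite card_eq_sym.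
have [||G [i0 _ [GF G_min]]] := @colorful_transversal _ _ _
    (fun h A B => dir_hull h A `<=` dir_hull h B) (@dir_hull_total R d)
    (fun h A B C => @subset_trans _ _ _ _) F F_finite F_nonempty k e [set: 'I_k]%SET.
- by rewrite cardsT card_ord.
- by rewrite cardsT card_ord.
exists i0; apply: card_le_trans (F_choice G GF) _; apply: subset_card_le.
(* For [h = e j], [x] lies in the set [G i] chosen for [j], hence in its hull, hence in that of
   [A]. *)
apply: setIS => x xG A FA; apply: (bigcap_dir_hull _ _ _ _ (F_convex _ _ FA)) => h Hh.
have [j /= jk <-] := e_surj h Hh.
have [i _ leG] := G_min j jk.
by apply: (leG A FA) => c; apply; exact: xG.
Qed.
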